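(* Let $S$ be a locally compact Hausdorff space with Borel $\sigma$-algebra $\mathscr{S}$, let $\mathscr{S}_0$ be an algebra of subsets of $S$ generating $\mathscr{S}$, and let $X=(X_1,\ldots,X_n)$ be an exchangeable random element of $S^n$. Assume: (a) for every $\epsilon>0$ there exist $V\in\mathscr{S}_0$ and a compact set $K$ with $V\subset K$ and $\mathbb{P}(X_1\in V)\ge1-\epsilon$; (b) for every $\epsilon>0$ and every $V\in\mathscr{S}_0$ there exist an open set $O$ and $W\in\mathscr{S}_0$ with $V\subset O\subset W$ and $\mathbb{P}(X_1\in W\setminus V)\le\epsilon$. Then for $N>n$, $X$ is $N$-extendible if and only if \[ \sup_g \frac{|\mathbb{E}\, g(X_1,\ldots,X_n)|}{\|U^N_n g\|}=1, \] where $g$ ranges over all finite linear combinations of indicator functions $\mathbf 1_{V_1\times\cdots\times V_n}$ with $V_1,\ldots,V_n\in\mathscr{S}_0$ such that $U^N_n g$ is not identically zero, and $\|\cdot\|$ is the sup norm on $S^N$.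
   Context: A random element of $S^n$ (product $\sigma$-algebra) is exchangeable if its law is invariant under all permutations of coordinates. For $N\ge n$, $X$ is $N$-extendible if there is an exchangeable random element $(Y_1,\ldots,Y_N)$ of $S^N$ with $(Y_1,\ldots,Y_n)$ equal in distribution to $X$. With $\mathfrak S[n,N]$ the set of injections $\{1,\ldots,n\}\to\{1,\ldots,N\}$ and $(N)_n=N(N-1)\cdots(N-n+1)$, for $g:S^n\to\mathbb{R}$, $U^N_n g(x_1,\ldots,x_N)=\frac1{(N)_n}\sum_{\sigma\in\mathfrak S[n,N]}g(x_{\sigma(1)},\ldots,x_{\sigma(n)})$. *)

(* Defs.v *)
From HB Require Import structures.
From mathcomp Require Import all_boot all_order all_algebra all_fingroup.
From mathcomp Require Import all_classical all_reals all_analysis.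
Set Implicit Arguments. Unset Strict Implicit. Unset Printing Implicit Defensive.
Import Order.TTheory GRing.Theory Num.Theory.
Local Open Scope classical_set_scope.
Local Open Scope ring_scope.

Definition algebra_of_sets (T : Type) (G : set (set T)) : Prop :=
  [/\ G set0, setC_closed G & setU_closed G].

Definition borel_sets (S : topologicalType) : set (set S) := <<s open >>.

Definition prod_borel (S : topologicalType) (k : nat) : set (set ('I_k -> S)) :=
  <<s [set A | exists (i : 'I_k) (B : set S), borel_sets B /\ A = [set x | B (x i)]] >>.

Definition random_element d (Omega : measurableType d) (S : topologicalType)
  (k : nat) (X : Omega -> ('I_k -> S)) : Prop :=
  forall A, prod_borel A -> measurable (X @^-1` A).

Definition exchangeable d (Omega : measurableType d) (R : realType)
  (P : probability Omega R) (S : topologicalType) (k : nat)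
  (X : Omega -> ('I_k -> S)) : Prop :=
  forall (s : 'S_k) (A : set ('I_k -> S)), prod_borel A ->
    P (X @^-1` A) = P ((fun w => X w \o s) @^-1` A).

Definition extendible d (Omega : measurableType d) (R : realType)
  (P : probability Omega R) (S : topologicalType) (n N : nat) (hnN : (n <= N)%N)
  (X : Omega -> ('I_n -> S)) : Prop :=
  exists (d' : measure_display) (Omega' : measurableType d')
         (P' : probability Omega' R) (Y : Omega' -> ('I_N -> S)),
    [/\ random_element Y, exchangeable P' Y &
        forall A, prod_borel A ->
          P' ((fun w => Y w \o widen_ord hnN) @^-1` A) = P (X @^-1` A)].

Definition rect (S : Type) (k : nat) (V : 'I_k -> set S) : set ('I_k -> S) :=
  [set x | forall i, V i (x i)].

Definition lincomb (R : realType) (S : Type) (k : nat)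
  (s : seq (R * ('I_k -> set S))) (x : 'I_k -> S) : R :=
  \sum_(c <- s) c.1 * \1_(rect c.2) x.

Definition Ustat (R : realType) (S : Type) (n N : nat)
  (g : ('I_n -> S) -> R) (x : 'I_N -> S) : R :=
  ((N ^_ n)%:R)^-1 *
    \sum_(f : {ffun 'I_n -> 'I_N} | injectiveb f) g (x \o f).

Definition supnorm (R : realType) (S : Type) (N : nat) (h : ('I_N -> S) -> R) : R :=
  sup [set `|h x| | x in [set: 'I_N -> S]].

Definition expect d (Omega : measurableType d) (R : realType)
  (P : probability Omega R) (T : Type) (g : T -> R) (X : Omega -> T) : R :=
  fine (\int[P]_w (g (X w))%:E).

(* Main.v *)
(** If [X] extends to an exchangeable [Y], then [E g(X) = E (U g)(Y)], so
    the ratios are at most [1], and [g = 1] attains [1].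

    Conversely, adding a large constant to [g] turns the norm bound into
    [E g(X) <= sup (U g)].  Let [p f] be the supremum of the symmetrization of a
    bounded [f] on [S^N].  The functional [g o (x_1, .., x_n) |-> E g(X)] is
    dominated by the sublinear [p], so by Hahn-Banach it extends to all bounded
    functions.  Its values on indicators form a finitely additive probability on
    _all_ subsets of [S^N], exchangeable because [p] vanishes on [f o s - f].
    The sets that can be squeezed between a closed and an open set of nearly the
    same mass form an algebra; by (b) it contains the cylinders over [S0].  By
    (a) compact sets carry almost all the mass, hence countable subadditivity
    holds on that algebra, and Caratheodory's extension is the law of [Y]. *)

Require Import Defs.
From HB Require Import structures.
From mathcomp Require Import all_boot all_order all_algebra all_fingroup.
From mathcomp Require Import all_classical all_reals all_analysis.
From mathcomp Require Import ring lra.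
Import Order.TTheory GRing.Theory Num.Theory.
Local Open Scope classical_set_scope.
Local Open Scope ring_scope.
Set Implicit Arguments. Unset Strict Implicit. Unset Printing Implicit Defensive.

(** * Hahn-Banach *)

(* Partial linear functionals are represented by their graphs; domination by [p]
   makes such a graph single-valued when [p 0 = 0]. *)
Definition sublinear_graph (R : realType) (V : lmodType R) (B : set V)
    (p : V -> R) (g : set (V * R)) : Prop :=
  (forall a u v, g u -> g v -> g (a *: u.1 + v.1, a * u.2 + v.2)) /\
  (forall u, g u -> B u.1 /\ u.2 <= p u.1).

(** Domination at [u.1 - v] and [w.1 + v] confines [c] between [u.2 - p (u.1 - v)] and
    [p (w.1 + v) - w.2]. Subadditivity puts every such lower bound below every upper one, so the
    supremum of the lower bounds works; homogeneity reduces a general [t] to these two cases. *)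
Lemma hahn_banach_step (R : realType) (V : lmodType R) (B : set V)
    (p : V -> R) (g : set (V * R)) (v : V) :
  (forall a x y, B x -> B y -> B (a *: x + y)) ->
  (forall x y, B x -> B y -> p (x + y) <= p x + p y) ->
  (forall (a : R) x, 0 < a -> B x -> p (a *: x) = a * p x) ->
  sublinear_graph B p g -> g !=set0 -> B v ->
  exists c, sublinear_graph B p
    [set z | exists u t, g u /\ z = (u.1 + t *: v, u.2 + t * c)].
Proof.
move=> Blin psub phom [glin gp] [u0 gu0] Bv.
have BD x y : B x -> B y -> B (x + y).
  by move=> Bx By; have := Blin 1 _ _ Bx By; rewrite scale1r.
have B0 : B 0 by have := Blin (-1) _ _ Bv Bv; rewrite scaleN1r addNr.
have BZ a x : B x -> B (a *: x).
  by move=> Bx; have := Blin a _ _ Bx B0; rewrite addr0.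
pose E := [set u.2 - p (u.1 - v) | u in g].
have key u w : g u -> g w -> u.2 - p (u.1 - v) <= p (w.1 + v) - w.2.
  move=> gu gw; rewrite lerBlDr addrAC lerBrDr.
  have [_] := gp _ (glin 1 _ _ gu gw).
  rewrite /= scale1r mul1r => /le_trans; apply.
  rewrite [X in p X](_ : _ = (w.1 + v) + (u.1 - v)); last first.
    by rewrite addrCA addrK addrC addrC.
  have [Bu _] := gp _ gu; have [Bw _] := gp _ gw.
  by apply: psub; apply: BD => //; rewrite -scaleN1r; exact: BZ.
have Eub : ubound E (p (u0.1 + v) - u0.2).
  by move=> _ [u gu <-]; exact: key.
have E0 : E !=set0 by exists (u0.2 - p (u0.1 - v)); exists u0.
have Esup : has_sup E by split => //; eexists; exact: Eub.
pose c := sup E.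
have cge u : g u -> u.2 - p (u.1 - v) <= c.
  by move=> gu; apply: sup_upper_bound => //; exists u.
have cle w : g w -> c <= p (w.1 + v) - w.2.
  by move=> gw; apply: ge_sup => // _ [u gu <-]; exact: key.
(* Closure is given only for [a *: u + v], so a multiple of [u] is written as [(a - 1) *: u + u]. *)
have gZ a u : g u -> g (a *: u.1, a * u.2).
  move=> gu; have := glin (a - 1) _ _ gu gu.
  by rewrite scalerBl scale1r subrK mulrBl mul1r subrK.
exists c; split => /=.
  move=> a _ _ [u [t [gu ->]]] [w [s [gw ->]]] /=.
  exists (a *: u.1 + w.1, a * u.2 + w.2), (a * t + s); split; first exact: glin.
  by congr pair => /=; [rewrite scalerDr scalerDl scalerA addrACA | ring].
move=> _ [u [t [gu ->]]] /=; have [Bu up] := gp _ gu.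
split; first by apply: BD => //; exact: BZ.
have [t0|t0|<-] := ltgtP 0 t; last by rewrite scale0r mul0r !addr0.
  have /= cle' := cle _ (gZ t^-1 _ gu).
  have -> : u.1 + t *: v = t *: (t^-1 *: u.1 + v).
    by rewrite scalerDr scalerA divff ?scale1r// gt_eqF.
  rewrite phom//; last by apply: BD => //; exact: BZ.
  rewrite -ler_pdivrMl// mulrDr mulrA mulVf ?gt_eqF// mul1r; lra.
have s0 : 0 < - t by rewrite oppr_gt0.
have /= cge' := cge _ (gZ (- t)^-1 _ gu).
have -> : u.1 + t *: v = (- t) *: ((- t)^-1 *: u.1 - v).
  by rewrite scalerBr scalerA divff ?scale1r ?scaleNr ?opprK// gt_eqF.
rewrite phom//; last by apply: BD; [exact: BZ|rewrite -scaleN1r; exact: BZ].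
rewrite -ler_pdivrMl// mulrDr [_ * (t * c)]mulrA [_^-1 * t](_ : _ = -1).
  by rewrite mulN1r; lra.
by rewrite invrN mulNr mulVf// lt_eqF.
Qed.

(** A maximal dominated graph has all of [B] as its domain, since otherwise the one-step extension
    would enlarge it. Starting from a graph rather than a function spares a proof that the initial
    functional is well defined. *)
Lemma hahn_banach (R : realType) (V : lmodType R) (B : set V)
    (p : V -> R) (f0 : set (V * R)) :
  (forall a x y, B x -> B y -> B (a *: x + y)) ->
  (forall x y, B x -> B y -> p (x + y) <= p x + p y) ->
  (forall (a : R) x, 0 < a -> B x -> p (a *: x) = a * p x) ->
  p 0 = 0 -> sublinear_graph B p f0 -> f0 !=set0 ->
  exists L : V -> R,
    [/\ forall a x y, B x -> B y -> L (a *: x + y) = a * L x + L y,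
        forall x, B x -> L x <= p x &
        forall u, f0 u -> L u.1 = u.2].
Proof.
move=> Blin psub phom p0 gf0 f00.
(* Zorn's lemma also considers the empty chain, hence the union with [f0]. *)
pose Q g := sublinear_graph B p (f0 `|` g).
have [g [[glin gp] gmax]] : exists g, Q g /\ forall h, g `<` h -> ~ Q h.
  apply: Zorn_bigcup => F FQ Ftot.
  (* Because [F] is a chain, any two points of the union lie in a single dominated graph inside
     it. *)
  have up u v : (f0 `|` \bigcup_(X in F) X) u -> (f0 `|` \bigcup_(X in F) X) v ->
      exists h, [/\ Q h, (f0 `|` h) u, (f0 `|` h) v &
        f0 `|` h `<=` f0 `|` \bigcup_(X in F) X].
    have sF X : F X -> f0 `|` X `<=` f0 `|` \bigcup_(X in F) X.
      by move=> FX; apply: setUS => z Xz; exists X.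
    move=> [fu|[X FX Xu]] [fv|[Y FY Yv]].
    - by exists set0; rewrite /Q !setU0; split => //; left.
    - by exists Y; split; [exact: FQ|left|right|exact: sF].
    - by exists X; split; [exact: FQ|right|left|exact: sF].
    - have [XY|YX] := Ftot _ _ FX FY.
        by exists Y; split; [exact: FQ|right; exact: XY|right|exact: sF].
      by exists X; split; [exact: FQ|right|right; exact: YX|exact: sF].
  split.
    move=> a u v Fu Fv; have [h [[hl _] hu hv]] := up _ _ Fu Fv.
    by apply; exact: hl.
  by move=> u Fu; have [h [[_ hp] hu _ _]] := up _ _ Fu Fu; exact: hp.
pose h := f0 `|` g.
have h0 : h !=set0 by case: f00 => u fu; exists u; left.
have fun_h x r s : h (x, r) -> h (x, s) -> r = s.
  suff H a b : h (x, a) -> h (x, b) -> a <= b.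
    by move=> hr hs; apply/eqP; rewrite eq_le !H.
  move=> ha hb; have := (gp _ (glin (-1) _ _ hb ha)).2.
  by rewrite /= scaleN1r addNr p0 mulN1r addrC subr_le0.
have dom x : B x -> exists r, h (x, r).
  move=> Bx; have [c hc] := hahn_banach_step Blin psub phom (conj glin gp) h0 Bx.
  set k := [set z | _] in hc.
  have hk : h `<=` k.
    by move=> u hu; exists u, 0; split; rewrite // scale0r mul0r !addr0 -surjective_pairing.
  have Qk : Q k.
    by rewrite /Q (_ : f0 `|` k = k)//; apply/setUidPr => u fu; apply: hk; left.
  have kg : k `<=` g.
    apply: contrapT => nkg; apply: (gmax k) => //; split => //.
    by move=> u gu; apply: hk; right.
  (* The pair [(x, c)] is reached as the difference of [u + (x, c)], which lies in [k], and [u]. *)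
  have [u hu] := h0; exists c; right.
  have := glin (-1) u ((u.1 + 1 *: x, u.2 + 1 * c)) hu.
  rewrite /= scale1r mul1r scaleN1r mulN1r !addKr.
  case; last by [].
    right; apply: kg; exists u, 1; split => //.
    by rewrite scale1r mul1r.
  move=> fxc; apply: kg; apply: hk; left; exact: fxc.
(* Off [B], where nothing is claimed, [L] takes the default value 0. *)
have /choice[L HL] : forall x, exists r, B x -> h (x, r).
  by move=> x; have [/dom[r]|nB] := pselect (B x); [exists r|exists 0].
exists L; split.
- move=> a x y Bx By; apply: (fun_h (a *: x + y)); first exact/HL/Blin.
  exact: (glin a _ _ (HL _ Bx) (HL _ By)).
- by move=> x Bx; have [] := gp _ (HL _ Bx).
- move=> u fu; have hu : h u by left.
  apply: (fun_h u.1); last by rewrite -surjective_pairing.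
  by apply: HL; have [] := gp _ hu.
Qed.

(** * Premeasures on an algebra of sets *)

(* [hG] is a parameter so that canonical structures can find [G]. *)
Definition algebra_type (T : pointedType) (G : set (set T))
  (hG : algebra_of_sets G) : Type := T.

HB.instance Definition _ (T : pointedType) (G : set (set T))
  (hG : algebra_of_sets G) := Pointed.copy (algebra_type hG) T.

HB.instance Definition _ (T : pointedType) (G : set (set T))
    (hG : algebra_of_sets G) :=
  isAlgebraOfSets.Build default_measure_display (algebra_type hG)
    (let: And3 G0 _ _ := hG in G0) (let: And3 _ _ GU := hG in GU)
    (let: And3 _ GC _ := hG in GC).


(** Countable subadditivity upgrades finite additivity to sigma-additivity on [G], and
    Caratheodory's theorem applies. The sample space is [T] itself with the sigma-algebra generated
    by [G], and [Y] is the identity. *)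
Lemma measure_extension_algebra (R : realType) (T : pointedType)
    (G : set (set T)) (m : set T -> R) :
  algebra_of_sets G ->
  (forall A, 0 <= m A) -> m setT = 1 ->
  (forall A B, G A -> G B -> A `&` B = set0 -> m (A `|` B) = m A + m B) ->
  (forall (A : set T) (F : (set T)^nat), G A -> (forall k, G (F k)) ->
     A `<=` \bigcup_k F k -> ((m A)%:E <= \sum_(0 <= k <oo) (m (F k))%:E)%E) ->
  exists d (Om : measurableType d) (P : probability Om R) (Y : Om -> T),
    forall A, G A -> measurable (Y @^-1` A) /\ P (Y @^-1` A) = (m A)%:E.
Proof.
move=> hG m0 mT mU mS; have [G0 GC GU] := hG.
pose f : set (algebra_type hG) -> \bar R := fun A => (m A)%:E.
have f0 : f set0 = 0%E.
  apply/eqP; rewrite eqe; have /eqP := mU _ _ G0 G0 (setI0 _).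
  by rewrite setU0 eq_sym -subr_eq0 addrK.
have fadd : measure_function.semi_additive f.
  by apply/additive2P => // A B /mU AB /AB{}AB /AB AB0; rewrite /f AB0 EFinD.
have fge0 A : (0 <= f A)%E by rewrite lee_fin.
have fsub : measurable_subset_sigma_subadditive f.
  by move=> A F mF mA AF; exact: mS.
pose fcm := isContent.Build _ _ R f fge0 fadd.
pose fc : {content set _ -> \bar R} := HB.pack f fcm.
have fm : measure_function.semi_sigma_additive f.
  exact: (@semiring_sigma_additive _ _ _ fc fsub).
pose fM : {measure set _ -> \bar R} :=
  HB.pack f (isMeasure.Build _ _ R f f0 fge0 fm).
pose Om := g_sigma_algebraType (@measurable _ (algebra_type hG)).
have [mu muE] : exists mu : {measure set Om -> \bar R},
    forall A, G A -> mu A = (m A)%:E.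
  exists (@measure_extension default_measure_display (algebra_type hG) R fM).
  by move=> A GA; rewrite /= /measure_extension measurable_mu_extE.
have GT : G setT by rewrite -setC0; exact: GC.
have mu1 : mu setT = 1%E by rewrite muE// mT.
case: mu muE mu1 => mu [mc mm] /= muE mu1.
pose muM : {measure set Om -> \bar R} := HB.pack mu mc mm.
pose P : probability Om R := HB.pack (Measure.sort muM) (Measure.class muM)
  (Measure_isProbability.Build _ _ _ (Measure.sort muM) mu1).
exists _, Om, P, id => A GA; split; first exact: sub_sigma_algebra.
exact: muE.
Qed.

(** * Regular sets of a finitely additive probability *)

(** All subsets are measured, because the Hahn-Banach functional has a value at every indicator. *)
Definition finitely_additive (R : realType) (T : Type) (m : set T -> R) : Prop :=
  [/\ forall A, 0 <= m A, m setT = 1 &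
      forall A B, A `&` B = set0 -> m (A `|` B) = m A + m B].

Lemma finitely_additive0 (R : realType) (T : Type) (m : set T -> R) :
  finitely_additive m -> m set0 = 0.
Proof.
move=> [_ _ mU]; apply/eqP; have /eqP := mU _ _ (setI0 (@set0 T)).
by rewrite setU0 eq_sym -subr_eq0 addrK.
Qed.

Lemma finitely_additive_le (R : realType) (T : Type) (m : set T -> R) (A B : set T) :
  finitely_additive m -> A `<=` B -> m A <= m B.
Proof.
move=> [m0 _ mU] AB; rewrite -(setDUK AB) mU ?lerDl//.
by rewrite setDE setICA setICr setI0.
Qed.

Lemma finitely_additive_leU (R : realType) (T : Type) (m : set T -> R) (A B : set T) :
  finitely_additive m -> m (A `|` B) <= m A + m B.
Proof.
move=> hm; have [m0 _ mU] := hm.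
have -> : A `|` B = A `|` (B `\` A).
  rewrite eqEsubset; split=> x; last by move=> [|[Bx _]]; [left|right].
  by have [Ax _|nAx [|]] := pselect (A x); [left|left|right].
rewrite mU ?lerD2l; last by rewrite setDE setICA setICr setI0.
by apply: finitely_additive_le => // x [].
Qed.

Lemma finitely_additive_le_sum (R : realType) (T : Type) (m : set T -> R) (I : Type)
    (r : seq I) (F : I -> set T) :
  finitely_additive m ->
  m (\big[setU/set0]_(i <- r) F i) <= \sum_(i <- r) m (F i).
Proof.
move=> hm; elim: r => [|i r IH]; first by rewrite !big_nil (finitely_additive0 hm).
by rewrite !big_cons (le_trans (finitely_additive_leU _ _ hm))// lerD2l.
Qed.

(** The inner set is closed rather than compact, so that complementation exchanges the two
    approximations; compactness enters separately, through tightness. *)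
Definition regular (R : realType) (T : topologicalType) (m : set T -> R)
    (A : set T) : Prop :=
  forall e, 0 < e -> exists C O,
    [/\ closed C, open O, C `<=` A, A `<=` O & m (O `\` C) <= e].

Lemma regular_algebra (R : realType) (T : topologicalType) (m : set T -> R) :
  finitely_additive m -> algebra_of_sets (regular m).
Proof.
move=> hm; split.
- move=> e e0; exists set0, set0; split => //; [exact: closed0|exact: open0|].
  by rewrite setD0 (finitely_additive0 hm) ltW.
- move=> A rA e e0; have [C [ O [cC oO CA AO CO]]] := rA _ e0.
  exists (~` O), (~` C); split; [exact: open_closedC|exact: closed_openC| | |].
  + exact: subsetC.
  + exact: subsetC.
  + by rewrite setDE setCK setIC -setDE.
- move=> A B rA rB e e0; have e2 : 0 < e / 2 by rewrite divr_gt0.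
  have [C [ O [cC oO CA AO CO]]] := rA _ e2.
  have [C' [ O' [cC' oO' CB BO CO']]] := rB _ e2.
  exists (C `|` C'), (O `|` O'); split; [exact: closedU|exact: openU| | |].
  + exact: setUSS.
  + exact: setUSS.
  + apply: (@le_trans _ _ (m ((O `\` C) `|` (O' `\` C')))).
      apply: finitely_additive_le => // x [[Ox|Ox] /not_orP[nC nC']]; first by left.
      by right.
    by rewrite (le_trans (finitely_additive_leU _ _ hm))// [leRHS]splitr lerD.
Qed.

(** Otherwise pick [x n] in [K] outside the first [n] sets. A cluster point in [K] lies in some
    [O k], yet the sequence avoids [O k] from index [k.+1] on. *)
Lemma compact_countable_cover (T : topologicalType) (K : set T)
    (O : (set T)^nat) :
  compact K -> (forall k, open (O k)) -> K `<=` \bigcup_k O k ->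
  exists n, K `<=` \big[setU/set0]_(k < n) O k.
Proof.
move=> cK oO KO; apply: contrapT => /forallNP nK.
have /choice[x xK] : forall n, exists x, K x /\ forall k, (k < n)%N -> ~ O k x.
  move=> n; have /existsNP[x /not_implyP[Kx nOx]] := nK n.
  exists x; split=> // k kn Okx; apply: nOx.
  by rewrite -bigcup_mkord; exists k.
have [|p [Kp clp]] := cK (x @ \oo) _.
  by exists 0%N => // n _; have [] := xK n.
have [k _ Okp] := KO _ Kp.
have [||y [[n kn <-] Oy]] := clp [set x n | n in [set n | (k < n)%N]] (O k).
- by exists k.+1 => // n /= kn; exists n.
- exact: open_nbhs_nbhs.
- by have [_ /(_ _ kn)] := xK n.
Qed.

(** Shrink [A] to a closed [C], cut it down to the compact [C] within [K], and enlarge each [F k] to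
    an open [U k] with excess [e / 3 * 2^-1 ^+ k.+1]. A finite subcover reduces the claim to finite
    subadditivity; shrinking, cutting and enlarging cost at most [e / 3] each. *)
Lemma regular_sigma_subadditive (R : realType) (T : topologicalType)
    (m : set T -> R) (A : set T) (F : (set T)^nat) :
  finitely_additive m ->
  (forall e, 0 < e -> exists K, compact K /\ m (~` K) <= e) ->
  regular m A -> (forall k, regular m (F k)) -> A `<=` \bigcup_k F k ->
  ((m A)%:E <= \sum_(0 <= k <oo) (m (F k))%:E)%E.
Proof.
move=> hm tight rA rF AF; have [m0 _ mU] := hm.
apply/lee_addgt0Pr => e e0; have e3 : 0 < e / 3 by rewrite divr_gt0.
have [C [ O [cC _ CA AO CO]]] := rA _ e3.
have [K [cK mK]] := tight _ e3.
have /choice[U HU] : forall k, exists U : set T,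
    [/\ open U, F k `<=` U & m U <= m (F k) + e / 3 * 2^-1 ^+ k.+1].
  move=> k; have ek : 0 < e / 3 * 2^-1 ^+ k.+1 by rewrite mulr_gt0// exprn_gt0.
  have [C' [U [_ oU CF FU CU]]] := rF k _ ek; exists U; split => //.
  apply: (@le_trans _ _ (m (F k `|` (U `\` C')))).
    apply: finitely_additive_le => // x Ux.
    have [Fx|nFx] := pselect (F k x); [by left|right].
    by split => // /CF.
  by rewrite (le_trans (finitely_additive_leU _ _ hm))// lerD2l.
have [n CKn] : exists n, C `&` K `<=` \big[setU/set0]_(k < n) U k.
  apply: compact_countable_cover.
  - by rewrite setIC; exact: compact_closedI.
  - by move=> k; have [] := HU k.
  - by move=> x [/CA /AF[k _ Fx] _]; exists k => //; have [_ FU _] := HU k; exact: FU.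
apply: (@le_trans _ _ (\sum_(0 <= k < n) (m (F k))%:E + e%:E)%E); last first.
  by rewrite leeD2r// nneseries_lim_ge// => k _; rewrite lee_fin.
rewrite sumEFin -EFinD lee_fin.
have geo : \sum_(0 <= k < n) (2^-1 ^+ k.+1 : R) <= 1.
  suff -> : \sum_(0 <= k < n) (2^-1 ^+ k.+1 : R) = 1 - 2^-1 ^+ n.
    by rewrite gerBl exprn_ge0.
  elim: n {CKn} => [|n IH]; first by rewrite big_nil expr0 subrr.
  by rewrite big_nat_recr//= IH !exprS; lra.
have : m (C `&` K) <= \sum_(0 <= k < n) m (F k) + e / 3.
  apply: (le_trans (finitely_additive_le hm CKn)).
  apply: (le_trans (finitely_additive_le_sum _ _ hm)).
  rewrite -(big_mkord xpredT (fun k => m (U k))).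
  apply: (@le_trans _ _ (\sum_(0 <= k < n) (m (F k) + e / 3 * 2^-1 ^+ k.+1))).
    by apply: ler_sum => k _; have [] := HU k.
  rewrite big_split/= lerD2l -mulr_sumr -[leRHS]mulr1 ler_wpM2l// ltW//.
have : m A <= m (C `&` K) + (m (O `\` C) + m (~` K)).
  apply: (@le_trans _ _ (m ((C `&` K) `|` ((O `\` C) `|` (~` K))))).
    apply: finitely_additive_le => // x /AO Ox.
    have [Kx|] := pselect (K x); last by right; right.
    have [Cx|nCx] := pselect (C x); [by left|by right; left].
  rewrite (le_trans (finitely_additive_leU _ _ hm))// lerD2l.
  exact: finitely_additive_leU.
lra.
Qed.

(** * Laws on product spaces *)

Lemma algebra_setT (T : Type) (G : set (set T)) : algebra_of_sets G -> G setT.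
Proof. by move=> [G0 GC _]; rewrite -setC0; exact: GC. Qed.

Lemma algebra_setI (T : Type) (G : set (set T)) :
  algebra_of_sets G -> setI_closed G.
Proof.
by move=> [_ GC GU] A B GA GB; rewrite -[_ `&` _]setCK setCI; apply/GC/GU; exact: GC.
Qed.

Lemma algebra_forall (T : Type) (G : set (set T)) (k : nat) (F : 'I_k -> set T) :
  algebra_of_sets G -> (forall i, G (F i)) -> G [set x | forall i, F i x].
Proof.
move=> hG GF; have [G0 GC GU] := hG.
rewrite (_ : mkset _ = \big[setI/setT]_(i < k) F i).
  by elim/big_ind : _ => //; [exact: algebra_setT|exact: algebra_setI].
apply/seteqP; split=> [x Fx|x Fx i]; first by elim/big_ind : _ => // A B; split.
by move: Fx; rewrite (bigD1 i)//= => -[].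
Qed.

Lemma sigma_algebra_algebra (T : Type) (G : set (set T)) :
  sigma_algebra setT G -> algebra_of_sets G.
Proof.
move=> [G0 GD GU]; split => // [A GA|A B GA GB]; first by rewrite -setTD; exact: GD.
by rewrite -bigcup2E; apply: GU => -[|[|k]].
Qed.

Lemma cylinder_rect (S : Type) (k : nat) (i : 'I_k) (V : set S) :
  [set x : 'I_k -> S | V (x i)] = rect (fun j => if j == i then V else setT).
Proof.
rewrite eqEsubset; split=> x /=; last by move=> /(_ i); rewrite eqxx.
by move=> Vx j; case: eqP => // ->.
Qed.

(** For fixed [i], the sets [B] whose cylinder at [i] belongs to [H] form a sigma-algebra containing
    [S0], hence contain all Borel sets. *)
Lemma prod_borel_sub (S : topologicalType) (S0 : set (set S)) (k : nat)
    (H : set (set ('I_k -> S))) :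
  <<s S0 >> = @borel_sets S -> sigma_algebra setT H ->
  (forall i V, S0 V -> H [set x | V (x i)]) -> @prod_borel S k `<=` H.
Proof.
move=> S0E sH S0H; apply: smallest_sub => // _ [i [B [Bb ->]]].
move: B Bb; rewrite -S0E; apply: smallest_sub => [|V /S0H//].
have [H0 HD HU] := sH; split=> [|A HA|F HF]; first exact: H0.
  by have := HD _ HA; rewrite !setTD.
rewrite (_ : mkset _ = \bigcup_n [set x | F n (x i)]); first exact: HU.
by rewrite eqEsubset; split=> x [n _ Fx]; exists n.
Qed.

Lemma prod_borel_cylinder (S : topologicalType) (k : nat) (i : 'I_k) (B : set S) :
  borel_sets B -> @prod_borel S k [set x | B (x i)].
Proof. by move=> Bb; apply: sub_sigma_algebra; exists i, B. Qed.

Lemma prod_borel_rect (S : topologicalType) (k : nat) (V : 'I_k -> set S) :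
  (forall i, borel_sets (V i)) -> prod_borel (rect V).
Proof.
move=> bV; apply: (@algebra_forall _ (@prod_borel S k) k (fun i => [set x | V i (x i)])).
  exact/sigma_algebra_algebra/smallest_sigma_algebra.
by move=> i; exact: prod_borel_cylinder.
Qed.

(** Dynkin's pi-lambda argument. Measurability of both preimages is carried inside the Dynkin class,
    since the complement and disjoint union steps need it. *)
Lemma eq_law_pi_system (R : realType) (T : Type) (G : set (set T))
    d1 (O1 : measurableType d1) (P1 : probability O1 R) (Y1 : O1 -> T)
    d2 (O2 : measurableType d2) (P2 : probability O2 R) (Y2 : O2 -> T) :
  setI_closed G ->
  (forall A, G A -> [/\ measurable (Y1 @^-1` A), measurable (Y2 @^-1` A) &
     P1 (Y1 @^-1` A) = P2 (Y2 @^-1` A)]) ->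
  forall A, <<s G >> A -> P1 (Y1 @^-1` A) = P2 (Y2 @^-1` A).
Proof.
move=> GI GE A; rewrite -setI_closed_g_dynkin_g_sigma_algebra//.
suff H : <<d G >> `<=` [set A | [/\ measurable (Y1 @^-1` A),
    measurable (Y2 @^-1` A) & P1 (Y1 @^-1` A) = P2 (Y2 @^-1` A)]].
  by move=> /H[].
apply: smallest_sub => //; split => /=.
- by rewrite /= !preimage_setT !probability_setT.
- move=> B [m1 m2 E]; rewrite /= -!preimage_setC.
  by split; [exact: measurableC|exact: measurableC|rewrite !probability_setC// E].
- move=> F tF mF; rewrite /= !preimage_bigcup.
  have m1 k : measurable (Y1 @^-1` F k) by have [] := mF k.
  have m2 k : measurable (Y2 @^-1` F k) by have [] := mF k.
  have b1 : measurable (\bigcup_k (Y1 @^-1` F k)) by exact: bigcupT_measurable.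
  have b2 : measurable (\bigcup_k (Y2 @^-1` F k)) by exact: bigcupT_measurable.
  split => //.
  have t1 : trivIset setT (fun k => Y1 @^-1` F k).
    by move=> i j _ _ [w [wi wj]]; apply: (tF i j) => //; exists (Y1 w).
  have t2 : trivIset setT (fun k => Y2 @^-1` F k).
    by move=> i j _ _ [w [wi wj]]; apply: (tF i j) => //; exists (Y2 w).
  rewrite !measure_semi_bigcup//.
  by apply: eq_eseriesr => k _; have [] := mF k.
Qed.

Lemma random_element_comp d (Omega : measurableType d) (S : topologicalType)
    (k l : nat) (f : 'I_l -> 'I_k) (Y : Omega -> 'I_k -> S) :
  random_element Y -> random_element (fun w => Y w \o f).
Proof.
move=> mY A; have := @prod_borel_sub S open l
  [set A | measurable ((fun w => Y w \o f) @^-1` A)].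
move=> /(_ erefl _ _ A); apply.
  split => /=; first by rewrite preimage_set0.
    by move=> B mB; rewrite setTD -preimage_setC; exact: measurableC.
  by move=> F mF; rewrite preimage_bigcup; exact: bigcupT_measurable.
move=> i V oV; apply: (mY [set x | V (x (f i))]).
by apply: prod_borel_cylinder; exact: sub_sigma_algebra.
Qed.

(** Rectangles over [S0] are stable under intersection and include the cylinders that generate the
    product sigma-algebra. *)
Lemma eq_law_rect (R : realType) (S : topologicalType) (S0 : set (set S)) (k : nat)
    d1 (O1 : measurableType d1) (P1 : probability O1 R) (Y1 : O1 -> 'I_k -> S)
    d2 (O2 : measurableType d2) (P2 : probability O2 R) (Y2 : O2 -> 'I_k -> S) :
  algebra_of_sets S0 -> <<s S0 >> = @borel_sets S ->
  random_element Y1 -> random_element Y2 ->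
  (forall V, (forall i, S0 (V i)) ->
     P1 (Y1 @^-1` rect V) = P2 (Y2 @^-1` rect V)) ->
  forall A, prod_borel A -> P1 (Y1 @^-1` A) = P2 (Y2 @^-1` A).
Proof.
move=> aS S0E mY1 mY2 E A pA.
pose G := [set B | exists2 V : 'I_k -> set S, forall i, S0 (V i) & B = rect V].
have S0b V : S0 V -> borel_sets V by rewrite -S0E; exact: sub_sigma_algebra.
apply: (@eq_law_pi_system R _ G).
- move=> _ _ [V SV ->] [W SW ->]; exists (fun i => V i `&` W i).
    by move=> i; exact: algebra_setI.
  rewrite eqEsubset; split=> x /=; first by move=> [Vx Wx] i; split.
  by move=> VWx; split=> i; have [] := VWx i.
- move=> _ [V SV ->]; have pV : prod_borel (rect V).
    by apply: prod_borel_rect => i; exact: S0b.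
  by split; [exact: mY1|exact: mY2|exact: E].
- apply: (prod_borel_sub S0E _ _ pA); first exact: smallest_sigma_algebra.
  move=> i V SV; rewrite cylinder_rect; apply: sub_sigma_algebra.
  exists (fun j => if j == i then V else setT) => // j.
  by case: eqP => // _; exact: algebra_setT.
Qed.

(** Integrability is proved jointly with the formula, because additivity of the integral needs it at
    each step of the induction on [s]. *)
Lemma expect_lincomb (R : realType) d (Omega : measurableType d)
    (P : probability Omega R) (S : topologicalType) (k : nat)
    (s : seq (R * ('I_k -> set S))) (X : Omega -> 'I_k -> S) :
  random_element X -> (forall c, c \in s -> forall i, borel_sets (c.2 i)) ->
  P.-integrable setT (EFin \o (lincomb s \o X)) /\
  expect P (lincomb s) X = \sum_(c <- s) c.1 * fine (P (X @^-1` rect c.2)).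
Proof.
move=> mX; elim: s => [|c s IH] bs.
  have -> : (EFin \o (@lincomb R S k [::] \o X)) = cst 0%E.
    by apply/funext => w /=; rewrite /lincomb big_nil.
  split; first exact: integrable0.
  rewrite /expect big_nil (_ : (fun _ => _) = cst 0%E) ?integral0//.
  by apply/funext => w /=; rewrite /lincomb big_nil.
have [|iS ES] := IH.
  by move=> c' c's; apply: (bs c'); rewrite inE c's orbT.
have mc : measurable (X @^-1` rect c.2).
  by apply: mX; apply: prod_borel_rect => i; apply: (bs c); rewrite inE eqxx.
have E : lincomb (c :: s) \o X =
    (fun w => c.1 * \1_(X @^-1` rect c.2) w + (lincomb s \o X) w).
  by apply/funext => w /=; rewrite /lincomb big_cons.
have i1 : P.-integrable setT (EFin \o (\1_(X @^-1` rect c.2) : Omega -> R)).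
  exact: integrable_indic.
have i2 : P.-integrable setT (EFin \o (fun w => c.1 * \1_(X @^-1` rect c.2) w)).
  by have := integrableZl measurableT c.1 i1; apply: eq_integrable.
split.
  by rewrite E; have := integrableD measurableT i2 iS; apply: eq_integrable.
rewrite big_cons -ES /expect.
transitivity (\int[P]_w (lincomb (c :: s) \o X) w); first by [].
rewrite E RintegralD//; congr (_ + _).
by rewrite RintegralZl// /Rintegral integral_indic// setIT.
Qed.

(** * U-statistics as averages over permutations *)

(** Induction on [n]: a permutation matching the first [n] points is followed by the transposition
    that corrects the last one. By injectivity this transposition moves none of the values already
    matched. *)
Lemma inj_eq_perm (T : finType) (n : nat) (f g : 'I_n -> T) :
  injective f -> injective g -> exists t : {perm T}, forall i, t (f i) = g i.
Proof.
elim: n f g => [|n IH] f g injf injg; first by exists 1%g => -[].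
have [||t tE] := IH (f \o widen_ord (leqnSn n)) (g \o widen_ord (leqnSn n)).
- by apply: inj_comp => // i j /(congr1 val) /= ij; exact: val_inj.
- by apply: inj_comp => // i j /(congr1 val) /= ij; exact: val_inj.
exists (t * tperm (t (f ord_max)) (g ord_max))%g => i; rewrite permM.
have [->|im] := eqVneq i ord_max; first by rewrite tpermL.
have lin : (i < n)%N.
  by rewrite ltn_neqAle -ltnS ltn_ord andbT; apply: contra im => /eqP ?; apply/eqP/val_inj.
have tfi : t (f i) = g i.
  by have := tE (Ordinal lin); rewrite /= (_ : widen_ord _ _ = i)//; exact: val_inj.
rewrite -tfi tpermD//.
- by rewrite (inj_eq perm_inj) (inj_eq injf) eq_sym.
- by rewrite tfi (inj_eq injg) eq_sym.
Qed.

(** Averages over a group can be reindexed by translation; this is how invariance is obtained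
    later. *)
Lemma sum_inj_perm (R : numFieldType) (n N : nat) (hnN : (n <= N)%N)
    (F : ('I_n -> 'I_N) -> R) :
  (N ^_ n)%:R^-1 * \sum_(f : {ffun 'I_n -> 'I_N} | injectiveb f) F f =
  N`!%:R^-1 * \sum_(s : 'S_N) F (s \o widen_ord hnN).
Proof.
pose w := widen_ord hnN.
have winj : injective w by move=> i j /(congr1 val) /= ij; exact: val_inj.
(* All fibers of [s |-> s o w] have the same size [K], by right translation;
   taking [F = 1] in [sumE] determines it. *)
pose K : R := \sum_(s : 'S_N | [ffun i => s (w i)] == [ffun i => w i]) 1.
have sumE G : \sum_(s : 'S_N) G (s \o w) =
    K * \sum_(f : {ffun 'I_n -> 'I_N} | injectiveb f) (G f : R).
  rewrite (partition_big (fun s : 'S_N => [ffun i => s (w i)])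
    (@injectiveb _ _))/=; last first.
    by move=> s _; apply/injectiveP => i j; rewrite !ffunE => /perm_inj /winj.
  rewrite mulr_sumr; apply: eq_bigr => f /injectiveP injf.
  have [t tE] := inj_eq_perm winj injf.
  rewrite (eq_bigr (fun=> 1 * G f)) => [|s /eqP <-]; last first.
    by rewrite mul1r; congr G; apply/funext => i; rewrite /= ffunE.
  rewrite -mulr_suml; congr (_ * _); rewrite /K (reindex_inj (mulIg t)).
  apply: eq_bigl => s; apply/eqP/eqP => /ffunP E; apply/ffunP => i.
    by have := E i; rewrite !ffunE permM -tE => /perm_inj.
  by have := E i; rewrite !ffunE permM -tE => ->.
have KE : N`!%:R = K * (N ^_ n)%:R :> R.
  have := sumE (fun=> 1); rewrite !sumr_const.
  rewrite (_ : #|_| = N`!); last by rewrite -[RHS]card_Sn; apply: eq_card.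
  move=> ->; congr (_ * _%:R).
  have := card_inj_ffuns 'I_n 'I_N; rewrite !card_ord => <-.
  by apply: eq_card => f; rewrite inE.
have N0 : (N ^_ n)%:R != 0 :> R by rewrite pnatr_eq0 -lt0n ffact_gt0.
have K0 : K != 0 :> R.
  apply: contraTneq isT => K0; have : N`!%:R == 0 :> R by rewrite KE K0 mul0r.
  by rewrite pnatr_eq0 -leqn0 leqNgt fact_gt0.
by rewrite sumE KE invfM mulrACA mulVf ?mul1r.
Qed.

Lemma UstatE (R : realType) (S : Type) (n N : nat) (hnN : (n <= N)%N)
    (g : ('I_n -> S) -> R) (x : 'I_N -> S) :
  Ustat g x = N`!%:R^-1 * \sum_(s : 'S_N) g (x \o s \o widen_ord hnN).
Proof. exact: (sum_inj_perm hnN (fun f => g (x \o f))). Qed.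

(** * Necessity *)

Lemma Rintegral_sum_seq (R : realType) d (Omega : measurableType d)
    (P : probability Omega R) (I : Type) (r : seq I) (h : I -> Omega -> R) :
  (forall i, P.-integrable setT (EFin \o h i)) ->
  P.-integrable setT (EFin \o (fun w => \sum_(i <- r) h i w)) /\
  \int[P]_w (\sum_(i <- r) h i w) = \sum_(i <- r) \int[P]_w h i w.
Proof.
move=> ih; elim: r => [|i r [i1 i2]].
  rewrite big_nil (_ : (fun w => _) = cst 0); last first.
    by apply/funext => w; rewrite big_nil.
  split; last by rewrite Rintegral_cst// mul0r.
  exact: integrable0.
rewrite (_ : (fun w => _) = (fun w => h i w + \sum_(i <- r) h i w)); last first.
  by apply/funext => w; rewrite big_cons.
split; last by rewrite RintegralD// big_cons i2.
by have := integrableD measurableT (ih i) i1; apply: eq_integrable.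
Qed.

Lemma prod_borel_comp_rect (S : topologicalType) (n N : nat) (f : 'I_n -> 'I_N)
    (V : 'I_n -> set S) :
  (forall i, borel_sets (V i)) ->
  prod_borel [set x : 'I_N -> S | rect V (x \o f)].
Proof.
move=> bV; apply: (@algebra_forall _ (@prod_borel S N) n
  (fun i => [set x | V i (x (f i))])).
  exact/sigma_algebra_algebra/smallest_sigma_algebra.
by move=> i; exact: prod_borel_cylinder.
Qed.

(** By exchangeability every [Z t] has the law of [X]. Averaging over [t] therefore gives the mean
    of the U-statistic at [Y], which inherits the pointwise bound. *)
Lemma extendible_le_Ustat (R : realType) d (Omega : measurableType d)
    (P : probability Omega R) (S : topologicalType) (n N : nat)
    (hnN : (n <= N)%N) (X : Omega -> 'I_n -> S)
    (s : seq (R * ('I_n -> set S))) (M : R) :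
  extendible P hnN X -> random_element X ->
  (forall c, c \in s -> forall i, borel_sets (c.2 i)) ->
  (forall x : 'I_N -> S, `|Ustat (lincomb s) x| <= M) ->
  `|expect P (lincomb s) X| <= M.
Proof.
move=> [d' [Om [P' [Y [mY eY XY]]]]] mX bs UM.
pose e := expect P (lincomb s) X; pose w := widen_ord hnN.
pose Z (t : 'S_N) (u : Om) := Y u \o t \o w.
have mZ t : random_element (Z t) by apply: (random_element_comp (t \o w) mY).
have Ze t : expect P' (lincomb s) (Z t) = e.
  (* Both expectations are sums of rectangle probabilities, so the two laws are compared on
     rectangles only. *)
  rewrite /e (expect_lincomb P' (mZ t) bs).2 (expect_lincomb P mX bs).2.
  rewrite !big_seq; apply: eq_bigr => c /bs bc; congr (_ * fine _).
  rewrite -XY; last exact: prod_borel_rect.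
  by rewrite -[LHS](eY t [set x : 'I_N -> S | rect c.2 (x \o w)])//; exact: prod_borel_comp_rect.
have [iZ eZ] := Rintegral_sum_seq (index_enum _)
  (fun t => (expect_lincomb P' (mZ t) bs).1).
have {}eZ : \int[P']_u (\sum_t (lincomb s \o Z t) u) = N`!%:R * e.
  rewrite eZ; transitivity (\sum_(t : 'S_N) e); first by apply: eq_bigr => t _; exact: (Ze t).
  by rewrite sumr_const mulr_natl -[in RHS]card_Sn; congr (_ *+ _); apply: eq_card.
have N0 : 0 < N`!%:R :> R by rewrite ltr0n fact_gt0.
have hU u : \sum_t (lincomb s \o Z t) u = N`!%:R * Ustat (lincomb s) (Y u).
  by rewrite (UstatE hnN) mulrA divff ?mul1r ?gt_eqF.
have icst (r : R) : P'.-integrable setT (EFin \o (cst r : Om -> R)).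
  exact: finite_measure_integrable_cst.
have cstE r : \int[P']_u (cst r u) = r.
  rewrite Rintegral_cst// -[RHS]mulr1; congr (_ * _).
  exact: (congr1 fine (probability_setT P')).
rewrite ler_norml; apply/andP; split.
  rewrite -(ler_pM2l N0) -/e -eZ -[leLHS]cstE; apply: le_Rintegral => //= u _.
  by rewrite hU ler_pM2l//; have := UM (Y u); rewrite ler_norml => /andP[].
rewrite -(ler_pM2l N0) -/e -eZ -[leRHS]cstE; apply: le_Rintegral => //= u _.
by rewrite hU ler_pM2l//; have := UM (Y u); rewrite ler_norml => /andP[].
Qed.

(** * Sufficiency *)

Lemma lincomb_bounded (R : realType) (S : Type) (k : nat)
    (s : seq (R * ('I_k -> set S))) (x : 'I_k -> S) :
  `|lincomb s x| <= \sum_(c <- s) `|c.1|.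
Proof.
rewrite (le_trans (ler_norm_sum _ _ _))//; apply: ler_sum => c _.
by rewrite normrM ler_piMr// indicE; case: (_ \in _); rewrite ?normr1 ?normr0.
Qed.

(** Realizes linear combinations at the level of lists, which makes the graph used for Hahn-Banach
    linear. *)
Lemma lincomb_scale_cat (R : realType) (S : Type) (k : nat) (a : R)
    (s t : seq (R * ('I_k -> set S))) (x : 'I_k -> S) :
  lincomb ([seq (a * c.1, c.2) | c <- s] ++ t) x = a * lincomb s x + lincomb t x.
Proof.
rewrite /lincomb big_cat/= big_map mulr_sumr; congr (_ + _).
by apply: eq_bigr => c _; rewrite mulrA.
Qed.

Lemma expect_scale_cat (R : realType) d (Omega : measurableType d)
    (P : probability Omega R) (S : topologicalType) (k : nat) (a : R)
    (s t : seq (R * ('I_k -> set S))) (X : Omega -> 'I_k -> S) :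
  random_element X ->
  (forall c, c \in s -> forall i, borel_sets (c.2 i)) ->
  (forall c, c \in t -> forall i, borel_sets (c.2 i)) ->
  expect P (lincomb ([seq (a * c.1, c.2) | c <- s] ++ t)) X =
  a * expect P (lincomb s) X + expect P (lincomb t) X.
Proof.
move=> mX bs bt; rewrite !(expect_lincomb P mX _).2//; last first.
  by move=> c; rewrite mem_cat => /orP[/mapP[c' /bs + ->]|/bt].
rewrite big_cat/= big_map mulr_sumr; congr (_ + _).
by apply: eq_bigr => c _; rewrite mulrA.
Qed.

Lemma exists_finitely_additive (R : realType) d (Omega : measurableType d)
    (P : probability Omega R) (S : topologicalType) (S0 : set (set S))
    (n N : nat) (hnN : (n <= N)%N) (X : Omega -> 'I_n -> S) (x0 : 'I_N -> S) :
  algebra_of_sets S0 -> S0 `<=` @borel_sets S -> random_element X ->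
  (forall (s : seq (R * ('I_n -> set S))) M,
     (forall c, c \in s -> forall i, S0 (c.2 i)) ->
     (forall x : 'I_N -> S, Ustat (lincomb s) x <= M) ->
     expect P (lincomb s) X <= M) ->
  exists m : set ('I_N -> S) -> R,
    [/\ finitely_additive m,
        forall (t : 'S_N) (A : set ('I_N -> S)), m [set x | A ((x : 'I_N -> S) \o t)] = m A &
        forall V, (forall i, S0 (V i)) ->
          m [set x : 'I_N -> S | rect V (x \o widen_ord hnN)] = fine (P (X @^-1` rect V))].
Proof.
move=> aS S0b mX EU; pose w := widen_ord hnN; pose T := 'I_N -> S.
(* On bounded functions the supremum defining [p] is a true one; elsewhere [sup] may be a default
   value. *)
pose B := [set f : T -> R^o | exists M, forall x, `|f x| <= M].
pose sym (f : T -> R^o) x : R := N`!%:R^-1 * \sum_(t : 'S_N) f (x \o t).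
pose p (f : T -> R^o) : R := sup (range (sym f)).
have N0 : 0 < N`!%:R^-1 :> R by rewrite invr_gt0 ltr0n fact_gt0.
have Ncst (M : R) : N`!%:R^-1 * \sum_(t : 'S_N) M = M.
  rewrite sumr_const -[M *+ _]mulr_natl mulrA (_ : #|_| = N`!).
    by rewrite mulVf ?mul1r// pnatr_eq0 -lt0n fact_gt0.
  by rewrite -[RHS]card_Sn; apply: eq_card.
have sym_le f M x : (forall y, f y <= M) -> sym f x <= M.
  by move=> fM; rewrite -[leRHS]Ncst ler_pM2l//; apply: ler_sum => t _.
have sym_p f x : B f -> sym f x <= p f.
  move=> [M fM]; apply: sup_upper_bound; last by exists x.
  split; first by exists (sym f x); exists x.
  exists M => _ [y _ <-]; apply: sym_le => z.
  exact: le_trans (ler_norm _) (fM z).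
have p_le f M : (forall x, sym f x <= M) -> p f <= M.
  move=> fM; apply: ge_sup; first by exists (sym f x0); exists x0.
  by move=> _ [y _ <-].
have symD f g x : sym (f + g) x = sym f x + sym g x.
  by rewrite /sym -mulrDr -big_split; congr (_ * _); apply: eq_bigr.
have symZ a f x : sym (a *: f) x = a * sym f x.
  by rewrite /sym mulrCA; congr (_ * _); rewrite mulr_sumr; apply: eq_bigr.
have Blin (a : R) f g : B f -> B g -> B (a *: f + g).
  move=> [M fM] [M' gM']; exists (`|a| * M + M') => x.
  rewrite (le_trans (ler_normD _ _))// lerD//.
  by rewrite normrM ler_wpM2l.
pose ext (g : ('I_n -> S) -> R) : T -> R^o := fun x => g (x \o w).
pose S0s (s : seq (R * ('I_n -> set S))) := forall c, c \in s -> forall i, S0 (c.2 i).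
have bS0s s : S0s s -> forall c, c \in s -> forall i, borel_sets (c.2 i).
  by move=> ss c cs i; apply: S0b; exact: ss cs i.
(* Different lists may represent the same function, so the functional is given as a relation. *)
pose f0 := [set u : (T -> R^o) * R | exists2 s, S0s s &
  u = (ext (lincomb s), expect P (lincomb s) X)].
have Bs s : B (ext (lincomb s)).
  by exists (\sum_(c <- s) `|c.1|) => x; exact: lincomb_bounded.
have p0 : p 0 = 0.
  have sym0 x : sym 0 x = 0 by rewrite /sym big1 ?mulr0.
  apply/eqP; rewrite eq_le; apply/andP; split.
    by apply: p_le => x; rewrite sym0.
  by rewrite -(sym0 x0); apply: sym_p; exists 0 => x; rewrite normr0.
have [||||L [Llin Lp Lf0]] := @hahn_banach R (T -> R^o) B p f0 Blin _ _ p0.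
- move=> f g Bf Bg; apply: p_le => x; rewrite symD.
  by apply: lerD; exact: sym_p.
- move=> a f a0 Bf; have aV : 0 < a^-1 by rewrite invr_gt0.
  have Baf : B (a *: f).
    by have := Blin (a - 1) f f Bf Bf; rewrite scalerBl scale1r subrK.
  apply/eqP; rewrite eq_le; apply/andP; split.
    by apply: p_le => x; rewrite symZ ler_pM2l//; exact: sym_p.
  rewrite -ler_pdivlMl//; apply: p_le => x.
  by rewrite ler_pdivlMl// -symZ; exact: sym_p.
- split.
    move=> a _ _ [s ss ->] [t tt ->] /=.
    exists ([seq (a * c.1, c.2) | c <- s] ++ t).
      by move=> c; rewrite mem_cat => /orP[/mapP[c' /ss + ->]|/tt].
    congr pair.
      by apply/funext => x; rewrite /ext lincomb_scale_cat.
    by rewrite expect_scale_cat//; exact: bS0s.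
  move=> _ [s ss ->] /=; split; first exact: Bs.
  (* The symmetrization of [ext g] is the U-statistic of [g], so [EU] with [M] equal to [p (ext g)]
     is exactly domination by [p]. *)
  by apply: EU => // x; rewrite (UstatE hnN); exact: (sym_p _ x (Bs s)).
- by exists (ext (lincomb [::]), expect P (lincomb [::]) X); exists [::].
pose I A : T -> R^o := \1_A; pose m A := L (I A).
have BI A : B (I A).
  by exists 1 => x; rewrite /I indicE; case: (_ \in _); rewrite ?normr1 ?normr0.
have LD f g : B f -> B g -> L (f + g) = L f + L g.
  by move=> Bf Bg; rewrite -[f]scale1r Llin// mul1r scale1r.
have LB f g : B f -> B g -> L (g - f) = L g - L f.
  by move=> Bf Bg; rewrite addrC -scaleN1r Llin// mulN1r addrC.
have B0 : B 0 by exists 0 => x; rewrite normr0.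
have mV V : (forall i, S0 (V i)) ->
    m [set x : 'I_N -> S | rect V (x \o w)] = fine (P (X @^-1` rect V)).
  move=> SV; have ss : S0s [:: (1, V)].
    by move=> c; rewrite inE => /eqP ->.
  have := Lf0 (ext (lincomb [:: (1, V)]), expect P (lincomb [:: (1, V)]) X).
  rewrite (expect_lincomb P mX (bS0s _ ss)).2 big_seq1 /= mul1r => <-; last first.
    exists [:: (1, V)] => //.
    by rewrite (expect_lincomb P mX (bS0s _ ss)).2 big_seq1 /= mul1r.
  congr L; apply/funext => x.
  by rewrite /ext /lincomb big_seq1 mul1r /I !indicE; congr (nat_of_bool _)%:R;
    rewrite !inE; apply/idP/idP => /set_mem; rewrite inE.
have L0 : L 0 = 0 by have := LB _ _ B0 B0; rewrite !subrr.
have BB f g : B f -> B g -> B (f - g).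
  by move=> Bf Bg; rewrite addrC -scaleN1r; exact: Blin.
exists m; split => //.
- split.
  (* The symmetrization of [- I A] is nonpositive, hence so are [p] and [L] at it. *)
  + move=> A; suff : L (0 - I A) <= 0 by rewrite LB// L0 sub0r oppr_le0.
    apply: (le_trans (Lp _ (BB _ _ B0 (BI A)))).
    apply: p_le => x; apply: sym_le => y.
    by rewrite -[leLHS]/(0 - \1_A y) sub0r oppr_le0 indicE.
  + have := mV (fun=> setT) (fun=> algebra_setT aS).
    rewrite (_ : mkset _ = setT); last by apply/seteqP; split.
    rewrite (_ : rect _ = setT); last by apply/seteqP; split.
    by rewrite preimage_setT probability_setT.
  + move=> A A' AA'; rewrite /m -LD//; congr L; apply/funext => x.
    rewrite -[RHS]/(\1_A x + \1_A' x) /I !indicE in_setU -natrD; congr _%:R.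
    have : ~~ ((x \in A) && (x \in A')) by rewrite -in_setI AA' in_set0.
    by case: (x \in A); case: (x \in A').
(* Reindexing by [t] shows that both indicators have the same symmetrization, so [p] is at most 0 at
   their difference. *)
- have le_m (t : 'S_N) (A : set T) : m [set x : T | A (x \o t)] <= m A.
    rewrite -subr_le0 /m -LB//.
    apply: (le_trans (Lp _ (BB _ _ (BI _) (BI A)))).
    apply: p_le => x; rewrite symD -scaleN1r symZ mulN1r subr_le0 /sym ler_pM2l//.
    rewrite [leRHS](reindex_inj (mulgI t)) /=; apply: ler_sum => u _.
    rewrite /I !indicE ler_nat (_ : x \o (t * u)%g = x \o u \o t); last first.
      by apply/funext => i; rewrite /= permM.
    suff -> : (x \o u \in [set y : T | A (y \o t)]) = (x \o u \o t \in A) by [].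
    by apply/idP/idP => /set_mem ?; exact/mem_set.
  move=> t A; apply/eqP; rewrite eq_le le_m /=.
  (* The reverse inequality is [le_m] for the inverse permutation, applied to the already permuted
     set. *)
  rewrite [leLHS](_ : _ = m [set x : T | [set y : T | A (y \o t)] (x \o (t^-1)%g)]).
    exact: le_m.
  congr m; apply/seteqP; split=> x /=; rewrite (_ : (x \o _) \o t = x)//;
    by apply/funext => i; rewrite /= permK.
Qed.

(** * From the norm bound to a one-sided bound *)

Lemma supnorm_le (R : realType) (S : Type) (N : nat) (h : ('I_N -> S) -> R)
    (x0 : 'I_N -> S) (M : R) :
  (forall x, `|h x| <= M) -> supnorm h <= M.
Proof.
move=> hM; apply: ge_sup; first by exists `|h x0|; exists x0.
by move=> _ [x _ <-].
Qed.

(** The bound [M] certifies that [sup] is a true supremum and not its default value. *)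
Lemma le_supnorm (R : realType) (S : Type) (N : nat) (h : ('I_N -> S) -> R)
    (M : R) (x : 'I_N -> S) :
  (forall y, `|h y| <= M) -> `|h x| <= supnorm h.
Proof.
move=> hM; apply: sup_upper_bound; last by exists x.
by split; [exists `|h x|, x|exists M => _ [y _ <-]].
Qed.

Lemma Ustat_cst (R : realType) (S : Type) (n N : nat) (hnN : (n <= N)%N)
    (a : R) (x : 'I_N -> S) : Ustat (n := n) (fun=> a) x = a.
Proof.
rewrite (UstatE hnN) sumr_const -[a *+ _]mulr_natl mulrA (_ : #|_| = N`!).
  by rewrite mulVf ?mul1r// pnatr_eq0 -lt0n fact_gt0.
by rewrite -[RHS]card_Sn; apply: eq_card.
Qed.

Lemma UstatD (R : realType) (S : Type) (n N : nat)
    (g h : ('I_n -> S) -> R) (x : 'I_N -> S) :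
  Ustat (fun y => g y + h y) x = Ustat g x + Ustat h x.
Proof. by rewrite /Ustat -mulrDr -big_split. Qed.

Lemma Ustat_norm_le (R : realType) (S : Type) (n N : nat) (hnN : (n <= N)%N)
    (g : ('I_n -> S) -> R) (M : R) (x : 'I_N -> S) :
  (forall y, `|g y| <= M) -> `|Ustat g x| <= M.
Proof.
move=> gM; rewrite -[leRHS](Ustat_cst hnN M x) /Ustat normrM ger0_norm ?invr_ge0//.
rewrite ler_wpM2l ?invr_ge0// (le_trans (ler_norm_sum _ _ _))//.
by apply: ler_sum => f _.
Qed.

Lemma lincomb1 (R : realType) (S : Type) (k : nat) :
  lincomb [:: (1 : R, fun _ : 'I_k => @setT S)] = fun=> 1.
Proof.
apply/funext => x; rewrite /lincomb big_seq1 mul1r indicE.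
by rewrite (_ : rect _ = setT) ?in_setT//; apply/seteqP; split.
Qed.

Lemma expect_lincomb1 (R : realType) d (Omega : measurableType d)
    (P : probability Omega R) (S : Type) (k : nat) (X : Omega -> 'I_k -> S) :
  expect P (lincomb [:: (1, fun _ : 'I_k => @setT S)]) X = 1.
Proof.
rewrite lincomb1 /expect -[LHS]/(Rintegral P setT (fun=> 1)) Rintegral_cst// mul1r.
exact: (congr1 fine (probability_setT P)).
Qed.

Lemma expect_le_Ustat (R : realType) d (Omega : measurableType d)
    (P : probability Omega R) (S : topologicalType) (S0 : set (set S))
    (n N : nat) (hnN : (n <= N)%N) (X : Omega -> 'I_n -> S) (x0 : 'I_N -> S) :
  algebra_of_sets S0 -> S0 `<=` @borel_sets S -> random_element X ->
  (forall s : seq (R * ('I_n -> set S)),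
     (forall c, c \in s -> forall i, S0 (c.2 i)) ->
     (exists x : 'I_N -> S, Ustat (lincomb s) x != 0) ->
     `|expect P (lincomb s) X| <= supnorm (Ustat (N := N) (lincomb s))) ->
  forall (s : seq (R * ('I_n -> set S))) (M : R),
    (forall c, c \in s -> forall i, S0 (c.2 i)) ->
    (forall x : 'I_N -> S, Ustat (lincomb s) x <= M) ->
    expect P (lincomb s) X <= M.
Proof.
move=> aS S0b mX EU s M Ss UM.
(* [K] bounds the U-statistic in absolute value. Shifting by [K + 1] makes it at least 1, hence not
   identically zero and equal to its absolute value, so its sup norm is at most [M + t]. *)
pose K := \sum_(c <- s) `|c.1|; pose t := K + 1.
pose s1 := [:: (1 : R, fun _ : 'I_n => @setT S)].
pose s' := [seq (t * c.1, c.2) | c <- s1] ++ s.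
have Ss1 c : c \in s1 -> forall i, S0 (c.2 i).
  by rewrite inE => /eqP -> i; exact: algebra_setT.
have Ss' c : c \in s' -> forall i, S0 (c.2 i).
  by rewrite mem_cat => /orP[/mapP[c' /Ss1 + ->]|/Ss].
have Us' (x : 'I_N -> S) : Ustat (lincomb s') x = t + Ustat (lincomb s) x.
  rewrite -[in RHS](Ustat_cst hnN t x) -UstatD; congr Ustat; apply/funext => y.
  by rewrite lincomb_scale_cat lincomb1 mulr1.
have Us (x : 'I_N -> S) : 1 <= t + Ustat (lincomb s) x.
  have := Ustat_norm_le hnN x (lincomb_bounded s).
  by rewrite -/K ler_norml => /andP[+ _]; rewrite /t; lra.
have := EU s' Ss'; rewrite expect_scale_cat//; last 2 first.
- by move=> c cs i; apply: S0b; exact: Ss1 cs i.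
- by move=> c cs i; apply: S0b; exact: Ss cs i.
rewrite expect_lincomb1 mulr1 => H.
have : `|t + expect P (lincomb s) X| <= M + t.
  apply: (le_trans (H _)).
    by exists x0; rewrite Us' gt_eqF// (lt_le_trans ltr01).
  apply: (supnorm_le x0) => x; rewrite Us' ger0_norm ?(le_trans ler01)//.
  by rewrite addrC lerD2r.
by move/(le_trans (ler_norm _)); rewrite addrC lerD2r.
Qed.

(** * Regularity and tightness on the product space *)

(** The open set comes from [outer] at [V], the closed one is the complement of the open set that
    [outer] gives at the complement of [V]. The gap between them is covered by the two small
    differences. *)
Lemma regular_cylinder (R : realType) (S : topologicalType) (N : nat)
    (m : set {ptws 'I_N -> S} -> R) (S0 : set (set S)) (i : 'I_N) (V : set S) :
  finitely_additive m -> algebra_of_sets S0 ->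
  (forall e, 0 < e -> forall V, S0 V -> exists O W,
     [/\ open O, S0 W, V `<=` O, O `<=` W & m [set x | (W `\` V) (x i)] <= e]) ->
  S0 V -> regular m [set x | V (x i)].
Proof.
move=> hm aS outer SV e e0; have e2 : 0 < e / 2 by rewrite divr_gt0.
have [ O [W [oO SW VO OW mW]]] := outer _ e2 _ SV.
have SV' : S0 (~` V) by have [_ SC _] := aS; exact: SC.
have [ O' [W' [oO' SW' VO' OW' mW']]] := outer _ e2 _ SV'.
have openC (U : set S) : open U -> open [set x : {ptws 'I_N -> S} | U (x i)].
  by move=> oU; apply: (open_comp _ oU) => x _; exact: (@proj_continuous _ (fun=> S) i).
exists [set x | (~` O') (x i)], [set x | O (x i)]; split.
- rewrite (_ : mkset _ = ~` [set x : {ptws 'I_N -> S} | O' (x i)])//.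
  by apply: open_closedC; exact: openC.
- exact: openC.
- by move=> x /= nO'; apply: contrapT => nV; apply: nO'; exact: VO'.
- by move=> x /VO.
- apply: (@le_trans _ _ (m ([set x | (W `\` V) (x i)] `|` [set x | (W' `\` ~` V) (x i)]))).
    apply: finitely_additive_le => // x [/= Ox /contrapT O'x].
    have [Vx|nVx] := pselect (V (x i)); [right|left]; split => //.
    + exact: OW'.
    + exact: OW.
  by rewrite (le_trans (finitely_additive_leU _ _ hm))// [leRHS]splitr lerD.
Qed.

(** The power of [K] is compact by Tychonoff, and a point outside it has some coordinate outside
    [V], so the union bound applies. *)
Lemma tight_product (R : realType) (S : topologicalType) (N : nat)
    (m : set {ptws 'I_N -> S} -> R) :
  finitely_additive m ->
  (forall e, 0 < e -> exists V K,
     [/\ compact K, V `<=` K & forall i, m [set x | (~` V) (x i)] <= e]) ->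
  forall e, 0 < e -> exists K, compact K /\ m (~` K) <= e.
Proof.
(* Dividing by [N.+1] instead of [N] covers the case [N = 0]. *)
move=> hm tight e e0; have eN : 0 < e / N.+1%:R by rewrite divr_gt0.
have [V [K [cK VK mV]]] := tight _ eN.
exists [set x | forall i, K (x i)]; split.
  exact: (@tychonoff 'I_N (fun=> S) (fun=> K) (fun=> cK)).
apply: (@le_trans _ _ (m (\big[setU/set0]_(i < N) [set x | (~` V) (x i)]))).
  apply: finitely_additive_le => // x /existsNP[i nKx].
  by rewrite (bigD1 i)//=; left => /VK.
rewrite (le_trans (finitely_additive_le_sum _ _ hm))//.
apply: (@le_trans _ _ (\sum_(i < N) e / N.+1%:R)); first exact: ler_sum.
rewrite sumr_const card_ord -[leLHS]mulr_natl mulrCA ler_piMr ?(ltW e0)//.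
by rewrite ler_pdivrMr// mul1r ler_nat.
Qed.

Lemma extendible_of_le_Ustat (R : realType) (S : topologicalType)
  (S0 : set (set S)) d (Omega : measurableType d)
  (P : probability Omega R) (n N : nat) (X : Omega -> ('I_n -> S))
  (hn : (0 < n)%N) (hnN : (n <= N)%N) :
  algebra_of_sets S0 -> <<s S0 >> = @borel_sets S -> random_element X ->
  (forall eps : R, 0 < eps ->
     exists V K, [/\ S0 V, compact K, V `<=` K &
       (1 - eps)%:E <= P ((fun w => X w (Ordinal hn)) @^-1` V)]%E) ->
  (forall eps : R, 0 < eps -> forall V, S0 V ->
     exists O W, [/\ open O, S0 W, V `<=` O, O `<=` W &
       (P ((fun w => X w (Ordinal hn)) @^-1` (W `\` V)) <= eps%:E)%E]) ->
  (forall (s : seq (R * ('I_n -> set S))) M,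
     (forall c, c \in s -> forall i, S0 (c.2 i)) ->
     (forall x : 'I_N -> S, Ustat (lincomb s) x <= M) ->
     expect P (lincomb s) X <= M) ->
  extendible P hnN X.
Proof.
move=> aS S0E mX inner outer EU; pose w := widen_ord hnN.
have S0b V : S0 V -> borel_sets V by rewrite -S0E; exact: sub_sigma_algebra.
(* [Omega] is pointed and [n] is positive, so [S] is inhabited; [x0] keeps the suprema nonempty and
   later serves as the point of [T]. *)
pose x0 : 'I_N -> S := fun=> X point (Ordinal hn).
have [m [hm mperm mV]] := exists_finitely_additive hnN x0 aS S0b mX EU.
(* Every one-dimensional marginal of [m] agrees on [S0] with the law of the first coordinate of [X]:
   a transposition moves [i] to that position, where [mV] applies with [setT] in the other
   factors. *)
have mcyl i V : S0 V -> m [set x | V (x i)] =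
    fine (P ((fun w => X w (Ordinal hn)) @^-1` V)).
  move=> SV; pose V' j := if j == Ordinal hn then V else setT.
  have SV' j : S0 (V' j) by rewrite /V'; case: eqP => // _; exact: algebra_setT.
  rewrite -[LHS](mperm (tperm i (w (Ordinal hn)))).
  have := mV _ SV'; rewrite -[rect V'](cylinder_rect (Ordinal hn) V) => <-.
  by congr m; apply/seteqP; split=> x /=; rewrite tpermL.
have mS V : borel_sets V -> measurable ((fun u => X u (Ordinal hn)) @^-1` V).
  by move=> bV; apply: (mX [set x | V (x (Ordinal hn))]); exact: prod_borel_cylinder.
have SC V : S0 V -> S0 (~` V) by have [_ + _] := aS; exact.
have fine_le (A : set Omega) (r : R) : measurable A -> (P A <= r%:E)%E = (fine (P A) <= r).
  by move=> mA; rewrite -lee_fin fineK// fin_num_measure.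
pose T : pointedType :=
  HB.pack ('I_N -> S) (gen_eqMixin ('I_N -> S)) (gen_choiceMixin ('I_N -> S))
    (isPointed.Build ('I_N -> S) x0).
have outer' (i : 'I_N) e : 0 < e -> forall V, S0 V -> exists O W,
    [/\ open O, S0 W, V `<=` O, O `<=` W & m [set x | (W `\` V) (x i)] <= e].
  move=> e0 V SV; have [U [W [oU SW VU UW PW]]] := outer _ e0 _ SV.
  have SWV : S0 (W `\` V) by rewrite setDE; apply: algebra_setI => //; exact: SC.
  exists U, W; split => //; rewrite mcyl// -fine_le//; apply: mS; exact: S0b.
have inner' e : 0 < e -> exists V K,
    [/\ compact K, V `<=` K & forall i, m [set x : 'I_N -> S | (~` V) (x i)] <= e].
  move=> e0; have [V [K [SV cK VK PV]]] := inner _ e0.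
  exists V, K; split => // i; rewrite mcyl; last exact: SC.
  rewrite -fine_le; last by apply: mS; apply: S0b; exact: SC.
  rewrite -preimage_setC probability_setC; last by apply: mS; exact: S0b.
  move: PV; rewrite -(fineK (fin_num_measure P _ (mS _ (S0b _ SV)))).
  by rewrite -EFinB !lee_fin; lra.
have tight := @tight_product R S N m hm inner'.
pose G := @regular R {ptws 'I_N -> S} m.
have aG : algebra_of_sets G by exact: regular_algebra.
have Gcyl i V : S0 V -> G [set x | V (x i)].
  by apply: (regular_cylinder hm aS) => e e0 W SW; exact: outer'.
have Grect k (f : 'I_k -> 'I_N) V : (forall i, S0 (V i)) ->
    G [set x : 'I_N -> S | rect V (x \o f)].
  move=> SV; exact: (algebra_forall (F := fun i => [set x : 'I_N -> S | V i (x (f i))])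
    aG (fun i => Gcyl (f i) _ (SV i))).
have [m0 mT mU] := hm.
have [d' [Om [P' [Y YG]]]] := @measure_extension_algebra R T G m aG m0 mT
  (fun A B _ _ => mU A B)
  
  (fun A F => @regular_sigma_subadditive R {ptws 'I_N -> S} m A F hm tight).
have mY : random_element (Y : Om -> 'I_N -> S).
  move=> A.
  apply: (prod_borel_sub S0E
    (H := [set A | measurable ((Y : Om -> 'I_N -> S) @^-1` A)])).
    split => /=; first by rewrite preimage_set0.
      by move=> B mB; rewrite setTD -preimage_setC; exact: measurableC.
    by move=> F mF; rewrite preimage_bigcup; exact: bigcupT_measurable.
  by move=> i V SV; have [] := YG _ (Gcyl i _ SV).
have PY k (f : 'I_k -> 'I_N) V : (forall i, S0 (V i)) ->
    P' (Y @^-1` [set x : 'I_N -> S | rect V (x \o f)]) =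
    (m [set x : 'I_N -> S | rect V (x \o f)])%:E.
  by move=> SV; have [] := YG _ (Grect k f V SV).
exists d', Om, P', Y; split => //.
(* On rectangles, exchangeability of the law of [Y] is the permutation invariance of [m]. *)
- move=> t; apply: (eq_law_rect aS S0E mY) => [|V SV]; first exact: random_element_comp.
  rewrite [RHS](PY _ t V SV) [RHS](_ : _ = (m (rect V))%:E); last first.
    by congr EFin; exact: mperm.
  exact: (PY _ id V SV).
- apply: (eq_law_rect aS S0E _ mX) => [|V SV]; first exact: random_element_comp.
  rewrite [LHS](PY _ w V SV) mV// fineK// fin_num_measure//.
  by apply: mX; apply: prod_borel_rect => i; exact: S0b.
Qed.

Theorem theorem5 (R : realType) (S : topologicalType)
  (S0 : set (set S)) (d : measure_display) (Omega : measurableType d)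
  (P : probability Omega R) (n N : nat) (X : Omega -> ('I_n -> S))
  (hn : (0 < n)%N) (hnN : (n < N)%N) :
  hausdorff_space S ->
  locally_compact [set: S] ->
  algebra_of_sets S0 ->
  <<s S0 >> = @borel_sets S ->
  random_element X ->
  exchangeable P X ->
  (forall eps : R, 0 < eps ->
     exists V K, [/\ S0 V, compact K, V `<=` K &
       (1 - eps)%:E <= P ((fun w => X w (Ordinal hn)) @^-1` V)]%E) ->
  (forall eps : R, 0 < eps -> forall V, S0 V ->
     exists O W, [/\ open O, S0 W, V `<=` O, O `<=` W &
       (P ((fun w => X w (Ordinal hn)) @^-1` (W `\` V)) <= eps%:E)%E]) ->
  (extendible P (ltnW hnN) X <->
   ereal_sup
     [set ((`|expect P (lincomb s) X| / supnorm (Ustat (N:=N) (lincomb s)))%:E)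
       | s in [set s : seq (R * ('I_n -> set S)) |
                 (forall c, c \in s -> forall i, S0 (c.2 i)) /\
                 exists x : 'I_N -> S, Ustat (N:=N) (lincomb s) x != 0]]
   = 1%E).
Proof.
move=> _ _ aS S0E mX _ inner outer.
have S0b V : S0 V -> borel_sets V by rewrite -S0E; exact: sub_sigma_algebra.
pose x0 : 'I_N -> S := fun=> X point (Ordinal hn).
have bs (s : seq (R * ('I_n -> set S))) :
    (forall c, c \in s -> forall i, S0 (c.2 i)) ->
    forall c, c \in s -> forall i, borel_sets (c.2 i).
  by move=> Ss c cs i; apply: S0b; exact: Ss cs i.
have Ub (s : seq (R * ('I_n -> set S))) (x : 'I_N -> S) :
    `|Ustat (lincomb s) x| <= supnorm (Ustat (N := N) (lincomb s)).
  apply: le_supnorm => y.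
  exact: (Ustat_norm_le (ltnW hnN) y (lincomb_bounded s)).
(* Positive denominators let each ratio bound be read as a bound of the expectation by the sup norm,
   and conversely. *)
have sn0 (s : seq (R * ('I_n -> set S))) :
    (exists x : 'I_N -> S, Ustat (lincomb s) x != 0) ->
    0 < supnorm (Ustat (N := N) (lincomb s)).
  by move=> [x Ux]; rewrite (lt_le_trans _ (Ub s x))// normr_gt0.
split=> [ext|sup1].
- apply/eqP; rewrite eq_le; apply/andP; split.
    apply: ge_ereal_sup => _ [s [Ss Us] <-].
    rewrite lee_fin ler_pdivrMr ?sn0// mul1r.
    by apply: (extendible_le_Ustat ext mX (bs s Ss)) => x; exact: Ub.
  apply: ereal_sup_ubound.
  have U1 : Ustat (lincomb [:: (1, fun _ : 'I_n => @setT S)]) = (fun=> 1)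
      :> (('I_N -> S) -> R).
    by apply/funext => x; rewrite lincomb1 (Ustat_cst (ltnW hnN)).
  exists [:: (1, fun=> setT)].
    split=> [c|]; last by exists x0; rewrite U1 oner_neq0.
    by rewrite inE => /eqP -> i; exact: algebra_setT.
  rewrite expect_lincomb1 U1 normr1 (_ : supnorm _ = 1) ?divr1//.
  apply/eqP; rewrite eq_le; apply/andP; split.
    by apply: (supnorm_le x0) => x; rewrite normr1.
  by have := @le_supnorm R S N (fun=> 1) 1 x0; rewrite normr1; apply.
- apply: (extendible_of_le_Ustat (ltnW hnN) aS S0E mX inner outer).
  apply: (expect_le_Ustat (ltnW hnN) x0 aS S0b mX) => s Ss Us.
  rewrite -[leRHS]mul1r -ler_pdivrMr ?sn0// -lee_fin -sup1.
  by apply: ereal_sup_ubound; exists s.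
Qed.
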